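(* For every finitely supported function $u:\mathbb{Z}^3\to\mathbb{C}$, \[ \mathcal{E}_3(u)-\frac14\sum_{x\in\mathbb{Z}^3\setminus\{0\}}\frac{|u(x)|^2}{|x|^2} \;\geq\; \frac{12}{13}|u(0)|^2+\sum_{x\in\mathbb{Z}^3\setminus\{0\}}\rho(|x|^2)\,|u(x)|^2 . \] Moreover, the right-hand side is strictly positive whenever $u\not\equiv 0$.
   Context: Let $e_1,e_2,e_3$ be the standard basis of $\mathbb{Z}^3$ and let $|x|$ denote the Euclidean norm of $x\in\mathbb{Z}^3$, so $|x|^2=x_1^2+x_2^2+x_3^2$. For a finitely supported function $u:\mathbb{Z}^3\to\mathbb{C}$, set \[ \mathcal{E}_3(u)=\sum_{x\in\mathbb{Z}^3}\sum_{j=1}^3|u(x+e_j)-u(x)|^2 . \] For $n\geq 1$, define \[ \rho(n)=\frac{928n^2+5356n-2197}{4n(8n+13)(64n^2+108n+169)} . \] *)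

(* Defs.v *)
From HB Require Import structures.
From mathcomp Require Import all_boot all_order all_algebra.
From mathcomp Require Import all_classical all_reals.
From mathcomp Require Import complex.

Set Implicit Arguments.
Unset Strict Implicit.
Unset Printing Implicit Defensive.

Import Order.TTheory GRing.Theory Num.Theory.
Local Open Scope classical_set_scope.
Local Open Scope ring_scope.
Local Open Scope complex_scope.

Notation Z3 := 'rV[int]_3.

Definition stdbasis (j : 'I_3) : Z3 := delta_mx 0 j.

Definition eucl (R : realType) (x : Z3) : R :=
  Num.sqrt (\sum_(j < 3) (x 0 j)%:~R ^+ 2).

Definition finitely_supported (R : realType) (u : Z3 -> R[i]) : Prop :=
  finite_set [set x | u x != 0].

(* The sums over Z^3 are the finitely supported sums of [fsbigop]; a sum of
   that kind is 0 when its support is infinite, so it is meaningful only for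
   finitely supported [u]. [normc] is the modulus with values in [R]. *)
Definition energy3 (R : realType) (u : Z3 -> R[i]) : R :=
  \sum_(x \in [set: Z3])
    \sum_(j < 3) ComplexField.Normc.normc (u (x + stdbasis j) - u x) ^+ 2.

Definition rho (R : realType) (n : R) : R :=
  (928 * n ^+ 2 + 5356 * n - 2197) /
  (4 * n * (8 * n + 13) * (64 * n ^+ 2 + 108 * n + 169)).

(* Main.v *)
Require Import Defs.
From HB Require Import structures.
From mathcomp Require Import all_boot all_order all_algebra.
From mathcomp Require Import all_classical all_reals.
From mathcomp Require Import complex finmap.
From mathcomp Require Import ring lra.

(** The inequality comes from a supersolution argument carried out edge by
edge. If [t * t' = 1] with [t, t' > 0], then completing the square gives
  [|a - b|^2 >= (1 - t) |a|^2 + (1 - t') |b|^2].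
With [t = phi y / phi x] on the edge from [x] to [y], summing over all edges
would bound the energy below by the potential [- Delta phi / phi]. In the
continuum [phi x = |x|^(-1/2)] is the optimal choice for Hardy's inequality in
dimension 3, so on the lattice one wants [phi x = (|x|^2 + 1)^(-1/4)], that is
[t = (q / p)^(-1/4)] where [p = |x|^2 + 1] and [q = |y|^2 + 1]. For the
edgewise bound it only matters that [t] is inverted when [x] and [y] are
exchanged. Hence [t] may be replaced by the rational function
[(5 p + 3 q) / (3 p + 5 q)], the Pade approximant of order [1/1] at [q = p],
which has the same symmetry;
[1 - t = 2 (q - p) / (3 p + 5 q)] is [edge_weight p q].

The edges at [x] in the directions [+ e_j] and [- e_j] then contribute
  [4 (S - 20 a^2) / (S^2 - 100 a^2)], with [n = |x|^2], [a = x_j], [S = 8 n + 13].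
This is a concave function of [a^2] on [[0, n]], so it lies above its chord
([axis_weight_ge]). The three chords add up to a function of [n] alone, because
the numbers [a^2] sum to [n]. The result, [hardy_weight n], takes the
value [12 / 13] at [n = 0] and is exactly [1 / (4 n) + rho n] for [n > 0], which
is the asserted inequality; it corresponds to [x] lying on a coordinate axis.
Positivity of the remainder holds because the numerator of [rho n] is positive
for [n >= 1]. *)

Set Implicit Arguments.
Unset Strict Implicit.
Unset Printing Implicit Defensive.

Import Order.TTheory GRing.Theory Num.Theory.
Local Open Scope classical_set_scope.
Local Open Scope ring_scope.
Local Open Scope complex_scope.

(** * The squared norm on the lattice *)

Definition sqnorm (R : realType) (x : Z3) : R :=
  \sum_(j < 3) (x 0 j)%:~R ^+ 2.

Lemma eucl_sqr (R : realType) (x : Z3) : eucl R x ^+ 2 = sqnorm R x.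
Proof. by rewrite /eucl sqr_sqrtr// sumr_ge0// => j _; exact: sqr_ge0. Qed.

Lemma sqnorm_ge0 (R : realType) (x : Z3) : 0 <= sqnorm R x.
Proof. by apply: sumr_ge0 => j _; exact: sqr_ge0. Qed.

Lemma sqnorm0 (R : realType) : sqnorm R 0 = 0.
Proof. by apply: big1 => j _; rewrite mxE expr0n. Qed.

Lemma sqr_coord_le (R : realType) (x : Z3) (j : 'I_3) :
  (x 0 j)%:~R ^+ 2 <= sqnorm R x.
Proof.
by rewrite /sqnorm (bigD1 j)//= lerDl sumr_ge0// => k _; exact: sqr_ge0.
Qed.

Lemma sqnorm_ge1 (R : realType) (x : Z3) : x != 0 -> 1 <= sqnorm R x.
Proof.
move=> /rV0Pn[j xj0]; apply: le_trans (sqr_coord_le R x j).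
rewrite -rmorphXn/= -[1]/(1%:~R) ler_int.
by rewrite -gtz0_ge1 exprn_even_gt0.
Qed.

Lemma sqnormDZ (R : realType) (x : Z3) (j : 'I_3) (c : int) :
  sqnorm R (x + c *: stdbasis j) =
  sqnorm R x + 2 * c%:~R * (x 0 j)%:~R + c%:~R ^+ 2.
Proof.
rewrite /sqnorm (bigD1 j)//= [in RHS](bigD1 j)//=.
rewrite (eq_bigr (fun k => (x 0 k)%:~R ^+ 2)); last first.
  by move=> k /negPf kj; rewrite /stdbasis !mxE eqxx kj mulr0 addr0.
rewrite /stdbasis !mxE !eqxx mulr1 rmorphD/=; ring.
Qed.

Lemma normc_sqr (R : realType) (z : R[i]) :
  ComplexField.Normc.normc z ^+ 2 = complex.Re z ^+ 2 + complex.Im z ^+ 2.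
Proof. by case: z => a b; rewrite /= sqr_sqrtr// addr_ge0// sqr_ge0. Qed.

(** * Weights on edges and on sites *)

Definition edge_weight (R : realType) (p q : R) : R :=
  2 * (q - p) / (3 * p + 5 * q).

(** The coefficients [1 - edge_weight p q] and [1 - edge_weight q p] are positive
and inverse to each other, so the difference of the two sides is a multiple of a
square. *)
Lemma sqrB_edge_weight_ge (R : realType) (p q a b : R) : 0 < p -> 0 < q ->
  edge_weight p q * a ^+ 2 + edge_weight q p * b ^+ 2 <= (a - b) ^+ 2.
Proof.
move=> p0 q0; rewrite -subr_ge0.
have d1 : 0 < 3 * p + 5 * q by lra.
have d2 : 0 < 3 * q + 5 * p by lra.
suff -> : (a - b) ^+ 2
    - (edge_weight p q * a ^+ 2 + edge_weight q p * b ^+ 2) =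
    ((5 * p + 3 * q) * a - (3 * p + 5 * q) * b) ^+ 2
      / ((3 * p + 5 * q) * (3 * q + 5 * p)).
  by rewrite divr_ge0 ?sqr_ge0// mulr_ge0 ?ltW.
by rewrite /edge_weight; field; rewrite !gt_eqF.
Qed.

Lemma normcB_edge_weight_ge (R : realType) (p q : R) (a b : R[i]) :
  0 < p -> 0 < q ->
  edge_weight p q * ComplexField.Normc.normc a ^+ 2
    + edge_weight q p * ComplexField.Normc.normc b ^+ 2
  <= ComplexField.Normc.normc (a - b) ^+ 2.
Proof.
move=> p0 q0; rewrite !normc_sqr.
case: a b => [a1 a2] [b1 b2] /=.
have := lerD (sqrB_edge_weight_ge a1 b1 p0 q0) (sqrB_edge_weight_ge a2 b2 p0 q0).
lra.
Qed.

(** The total coefficient that a site receives from its six edges, the discrete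
analogue of [- Delta phi / phi]. *)
Definition site_weight (R : realType) (x : Z3) : R :=
  \sum_(j < 3)
    (edge_weight (sqnorm R x + 1) (sqnorm R (x + stdbasis j) + 1)
     + edge_weight (sqnorm R x + 1) (sqnorm R (x - stdbasis j) + 1)).

(** The sum of the potential [1 / (4 n)] and the remainder [rho n], in a form that
is also meaningful at the origin. *)
Definition hardy_weight (R : realType) (n : R) : R :=
  4 * (32 * n ^+ 2 + 164 * n + 507)
    / ((8 * n + 13) * (64 * n ^+ 2 + 108 * n + 169)).

(** The right-hand side is a concave function of [a ^ 2], and the left-hand side is
its chord between [a ^ 2 = 0] and [a ^ 2 = n]: the exact value has
[S ^ 2 - 100 a ^ 2] where the chord has
[S ^ 2 - 100 n = 64 n ^ 2 + 108 n + 169], with [S = 8 n + 13]. *)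
Lemma axis_weight_ge (R : realType) (n a : R) : 0 <= n -> a ^+ 2 <= n ->
  4 / (8 * n + 13)
    - 80 * (8 * n + 8) * a ^+ 2
      / ((8 * n + 13) * (64 * n ^+ 2 + 108 * n + 169))
  <= edge_weight (n + 1) (n + 2 * a + 1 + 1)
     + edge_weight (n + 1) (n - 2 * a + 1 + 1).
Proof.
move=> n0 an; set S := 8 * n + 13; set D := _ + 169.
have n20 : 0 <= n ^+ 2 by exact: sqr_ge0.
have S0 : 0 < S by rewrite /S; lra.
have D0 : 0 < D by rewrite /D; lra.
have DE : D = S ^+ 2 - 100 * n by rewrite /D /S; ring.
have Da : 0 < S ^+ 2 - 100 * a ^+ 2 by lra.
(* Both factors of S ^ 2 - 100 a ^ 2 > 0 are positive since their sum is. *)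
have Sp : 0 < S + 10 * a.
  by rewrite ltNge; apply/negP => h; nra.
have Sm : 0 < S - 10 * a.
  by rewrite ltNge; apply/negP => h; nra.
have -> : edge_weight (n + 1) (n + 2 * a + 1 + 1)
     + edge_weight (n + 1) (n - 2 * a + 1 + 1) =
  4 / S - 80 * (8 * n + 8) * a ^+ 2 / (S * (S ^+ 2 - 100 * a ^+ 2)).
  rewrite /edge_weight.
  have -> : 3 * (n + 1) + 5 * (n + 2 * a + 1 + 1) = S + 10 * a.
    by rewrite /S; ring.
  have -> : 3 * (n + 1) + 5 * (n - 2 * a + 1 + 1) = S - 10 * a.
    by rewrite /S; ring.
  have -> : 8 * n + 8 = S - 5 by rewrite /S; ring.
  have -> : S ^+ 2 - 100 * a ^+ 2 = (S + 10 * a) * (S - 10 * a) by ring.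
  by field; rewrite !gt_eqF.
rewrite lerD2l lerN2 ler_wpM2l//.
  by rewrite mulr_ge0 ?sqr_ge0//; lra.
rewrite lef_pV2 ?posrE ?mulr_gt0// ler_pM2l//; lra.
Qed.

(** The chords are affine in [x_j ^ 2] with coefficients depending on [|x| ^ 2] only,
so their sum over the three axes is a function of [|x| ^ 2]. *)
Lemma site_weight_ge (R : realType) (x : Z3) :
  hardy_weight (sqnorm R x) <= site_weight R x.
Proof.
set n := sqnorm R x.
have n0 : 0 <= n by exact: sqnorm_ge0.
have n20 : 0 <= n ^+ 2 by exact: sqr_ge0.
have S0 : 0 < 8 * n + 13 by lra.
have D0 : 0 < 64 * n ^+ 2 + 108 * n + 169 by lra.
have -> : hardy_weight n = \sum_(j < 3)
   (4 / (8 * n + 13)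
    - 80 * (8 * n + 8) * (x 0 j)%:~R ^+ 2
      / ((8 * n + 13) * (64 * n ^+ 2 + 108 * n + 169))).
  rewrite sumrB sumr_const card_ord -mulr_suml -mulr_sumr -/(sqnorm R x) -/n.
  by rewrite /hardy_weight; field; rewrite !gt_eqF.
apply: ler_sum => j _.
have := axis_weight_ge n0 (sqr_coord_le R x j).
have := sqnormDZ R x j 1; rewrite scale1r => ->.
have := sqnormDZ R x j (-1); rewrite scaleN1r => ->.
rewrite -/n rmorphN rmorph1 sqrrN expr1n mulr1 mulrN1 mulNr.
exact.
Qed.

Lemma hardy_weight0 (R : realType) : hardy_weight 0 = 12 / 13 :> R.
Proof. by rewrite /hardy_weight; field. Qed.

Lemma hardy_weightE (R : realType) (n : R) : 0 < n ->
  hardy_weight n = 1 / 4 / n + rho n.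
Proof.
move=> n0; have n20 : 0 <= n ^+ 2 by exact: sqr_ge0.
have S0 : 0 < 8 * n + 13 by lra.
have D0 : 0 < 64 * n ^+ 2 + 108 * n + 169 by lra.
by rewrite /hardy_weight /rho; field; rewrite !gt_eqF.
Qed.

Lemma rho_gt0 (R : realType) (n : R) : 1 <= n -> 0 < rho n.
Proof.
move=> n1; have n20 : 0 <= n ^+ 2 by exact: sqr_ge0.
by rewrite divr_gt0 ?mulr_gt0//; lra.
Qed.

(** * Summation over a finite window *)

Lemma fsum_set_neq0 (R : realType) (F : {fset Z3}) (f : Z3 -> R) :
  (forall x, x \notin F -> f x = 0) ->
  \sum_(x \in [set~ (0 : Z3)]) f x = \sum_(x <- F | x != 0) f x.
Proof.
move=> fF; rewrite fsbig_mkcond [in RHS]big_mkcond/= (fsbigTE F) => [|x /fF fx].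
  by apply: eq_bigr => x _; rewrite /patch in_setC in_set1; case: eqP.
by rewrite /patch; case: ifP.
Qed.

Lemma sum_shift (R : realType) (F : {fset Z3}) (e : Z3) (f : Z3 -> R) :
  (forall x, f x != 0 -> x \in F) -> (forall x, f (x + e) != 0 -> x \in F) ->
  \sum_(x <- F) f (x + e) = \sum_(x <- F) f x.
Proof.
move=> fF feF.
rewrite -[RHS](@fsbigTE _ _ _ _ F f); last first.
  by move=> x; apply: contraNeq; exact: fF.
rewrite -[LHS](@fsbigTE _ _ _ _ F (fun x => f (x + e))); last first.
  by move=> x; apply: contraNeq; exact: feF.
rewrite [RHS](@reindex_fsbigT _ _ _ _ _ (fun x => x + e))//.
by exists (fun x => x - e) => x; rewrite ?addrK ?subrK.
Qed.

(** All the sums of the theorem can be restricted to one finite set: it has to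
contain the support of [u] and the lower end of every edge meeting that support.
The origin is added so that its term can be split off. *)
Lemma finite_window (R : realType) (u : Z3 -> R[i]) :
  finitely_supported u ->
  exists F : {fset Z3}, [/\ 0 \in F, forall x, u x != 0 -> x \in F
    & forall x j, u (x + stdbasis j) != 0 -> x \in F].
Proof.
move=> hu.
pose A := [set (0 : Z3)] `|` [set x | u x != 0] `|`
  \bigcup_(j in [set: 'I_3]) ((fun x => x - stdbasis j) @` [set x | u x != 0]).
have fA : finite_set A.
  rewrite /A !finite_setU; split; first by split.
  by apply: bigcup_finite => // j _; exact: finite_image.
exists (fset_set A); split=> [|x ux|x j ux]; rewrite in_fset_set//; apply: mem_set.
- by left; left.
- by left; right.
- by right; exists j => //; exists (x + stdbasis j); rewrite ?addrK.
Qed.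

(** Each edge is counted in the energy at its lower end [x]; the share of its upper
end [x + e_j] is brought to that site by translating the summation index, after
which it is the contribution of the edge in direction [- e_j]. *)
Lemma energy3_ge (R : realType) (u : Z3 -> R[i]) (F : {fset Z3}) :
  (forall x, u x != 0 -> x \in F) ->
  (forall x j, u (x + stdbasis j) != 0 -> x \in F) ->
  \sum_(x <- F) site_weight R x * ComplexField.Normc.normc (u x) ^+ 2
  <= energy3 u.
Proof.
move=> uF ueF.
have n0 : ComplexField.Normc.normc (0 : R[i]) = 0.
  exact: ComplexField.Normc.normc0.
have p0 (x : Z3) : 0 < sqnorm R x + 1 by have := sqnorm_ge0 R x; lra.
rewrite /energy3 (fsbigTE F) => [|x xF]; last first.
  apply: big1 => j _.
  have -> : u x = 0 by apply/eqP; apply: contraNT xF; exact: uF.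
  have -> : u (x + stdbasis j) = 0.
    by apply/eqP; apply: contraNT xF; exact: ueF.
  by rewrite subr0 n0 expr0n.
pose wp (j : 'I_3) x := edge_weight (sqnorm R x + 1)
  (sqnorm R (x + stdbasis j) + 1) * ComplexField.Normc.normc (u x) ^+ 2.
pose wm (j : 'I_3) x := edge_weight (sqnorm R x + 1)
  (sqnorm R (x - stdbasis j) + 1) * ComplexField.Normc.normc (u x) ^+ 2.
have wm_supp j x : wm j x != 0 -> u x != 0.
  by apply: contraNneq => ux; rewrite /wm ux n0 expr0n mulr0.
have -> : \sum_(x <- F) site_weight R x * ComplexField.Normc.normc (u x) ^+ 2 =
    \sum_(j < 3) \sum_(x <- F) (wp j x + wm j (x + stdbasis j)).
  under eq_bigr do rewrite /site_weight mulr_suml.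
  rewrite exchange_big/=; apply: eq_bigr => j _.
  rewrite [RHS]big_split/= sum_shift.
  - by rewrite -big_split/=; apply: eq_bigr => x _; rewrite mulrDl.
  - by move=> x /wm_supp /uF.
  - by move=> x /wm_supp /ueF.
rewrite exchange_big/=; apply: ler_sum => x _; apply: ler_sum => j _.
rewrite /wp /wm addrK addrC.
exact: normcB_edge_weight_ge.
Qed.

(** * The improved Hardy inequality *)

Unset Implicit Arguments.

Theorem theorem2p1 (R : realType) (u : Z3 -> R[i])
    (hu : finitely_supported u) :
  energy3 u
    - 1 / 4 * \sum_(x \in [set~ (0 : Z3)])
        (ComplexField.Normc.normc (u x) ^+ 2 / eucl R x ^+ 2)
  >= 12 / 13 * ComplexField.Normc.normc (u 0) ^+ 2
     + \sum_(x \in [set~ (0 : Z3)])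
        (rho (eucl R x ^+ 2) * ComplexField.Normc.normc (u x) ^+ 2)
  /\
  (~ (forall x : Z3, u x = 0) ->
   0 < 12 / 13 * ComplexField.Normc.normc (u 0) ^+ 2
       + \sum_(x \in [set~ (0 : Z3)])
          (rho (eucl R x ^+ 2) * ComplexField.Normc.normc (u x) ^+ 2)).
Proof.
have [F [F0 uF ueF]] := finite_window hu.
have nF x : x \notin F -> ComplexField.Normc.normc (u x) = 0.
  by move=> /(contraNT (uF x))/eqP ->; exact: ComplexField.Normc.normc0.
rewrite !(fsum_set_neq0 (F := F)); try by move=> x /nF ->;
  rewrite expr0n ?mul0r ?mulr0.
split.
- rewrite lerBrDr; apply: le_trans (energy3_ge uF ueF).
  rewrite [leRHS](bigD1_seq 0) ?fset_uniq//= -addrA lerD//.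
    by rewrite ler_wpM2r ?sqr_ge0// -hardy_weight0 -(sqnorm0 R) site_weight_ge.
  rewrite mulr_sumr -big_split/=; apply: ler_sum => x x0.
  have n1 := sqnorm_ge1 R x0.
  rewrite eucl_sqr [leLHS](_ : _ = hardy_weight (sqnorm R x)
      * ComplexField.Normc.normc (u x) ^+ 2).
    by rewrite ler_wpM2r ?sqr_ge0// site_weight_ge.
  by rewrite hardy_weightE ?(lt_le_trans ltr01)//; ring.
- move=> /existsNP[x /eqP ux].
  have cx : 0 < ComplexField.Normc.normc (u x) ^+ 2.
    rewrite exprn_even_gt0//=; apply: contraNneq ux.
    by move=> /ComplexField.Normc.eq0_normc ->.
  have rho_ge0 y : y != 0 ->
      0 <= rho (eucl R y ^+ 2) * ComplexField.Normc.normc (u y) ^+ 2.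
    by move=> y0; rewrite mulr_ge0 ?sqr_ge0// eucl_sqr ltW// rho_gt0// sqnorm_ge1.
  have [x0|x0] := eqVneq x 0.
    move: cx; rewrite x0 => cx; rewrite ltr_wpDr//.
      by apply: sumr_ge0 => y; exact: rho_ge0.
    by rewrite mulr_gt0// divr_gt0.
  rewrite ltr_wpDl//.
    by rewrite mulr_ge0 ?sqr_ge0// divr_ge0.
  rewrite (big_rem x) ?uF//= x0 ltr_wpDr//.
    by apply: sumr_ge0 => y; exact: rho_ge0.
  by rewrite mulr_gt0// eucl_sqr rho_gt0// sqnorm_ge1.
Qed.
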